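(* Let $(X_n)_{n\in\mathbb{N}}$ be a locally Markov walk on a finite, strongly connected directed graph $G=(V,E)$, with local transition matrices $\mathsf{M}_x=(\mathsf{m}_x(y,z))_{y,z\in N_x}$, $x\in V$. Assume that all local chains have strictly positive transition probabilities, i.e. $\mathsf{m}_x(y,z)>0$ for all $x\in V$ and all $y,z\in N_x$. Let $Q=(q_x(y))_{x,y\in V}$ be the stochastic matrix indexed over $V\times V$ whose row at index $x\in V$ is the stationary distribution $q_x$ of the local chain at $x$ (so $q_x\mathsf{M}_x=q_x$), extended by $q_x(y)=0$ for $y\notin N_x$. Then: (1) The stationary distribution of the total chain $(X_n,\rho_n)_{n\in\mathbb{N}}$ associated with $(X_n)_{n\in\mathbb{N}}$ is obtained from the $q$-weighted spanning unicycles of $G$; explicitly, it is the distribution $\mu$ given by $$\mu(x,\rho)=\begin{cases}\dfrac1Z\displaystyle\prod_{y\in V}q_y(\rho(y)), & \text{if }\rho\setminus x\in\mathsf{TREE}_x(G),\\[2mm] 0,&\text{otherwise,}\end{cases}\qquad Z=\sum_{x\in V}\ \sum_{T\in\mathsf{TREE}_x(G)}\ \prod_{(y,z)\in T}q_y(z).$$ (2) For all $x,y\in V$, $$\lim_{n\to\infty}\mathbb{P}(X_{n+1}=x\mid X_n=y)=q_y(x).$$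
   Context: Graph: $G=(V,E)$ is a finite, strongly connected directed graph without loops; $N_x=\{y\in V:(x,y)\in E\}$. Local chains: for every $x\in V$ a stochastic matrix $\mathsf{M}_x=(\mathsf{m}_x(y,z))_{y,z\in N_x}$ is given, the transition matrix of the local chain at $x$, which has state space $N_x$. Configurations: a configuration is a map $\rho:V\to V$ with $\rho(x)\in N_x$ for all $x$. Locally Markov walk and total chain: a random walk $(X_n)_{n\in\mathbb{N}}$ on $G$ is a locally Markov walk if for every $x\in V$ the sequence of successive exits from $x$ (the vertices to which the walk moves immediately after its successive visits to $x$) is a Markov chain, called the local chain at $x$; here its transition matrix is $\mathsf{M}_x$. The initial states of the local chains may be fixed or random. Let $\rho_n(x)$ be the vertex to which the walk moved at its most recent exit from $x$ before time $n$ (equal to the initial state $\rho_0(x)$ if there was none). The total chain is the Markov chain $(X_n,\rho_n)_{n\in\mathbb{N}}$ with one-step transition probabilities $$p((x,\rho),(y,\eta))=\begin{cases}\mathsf{m}_x(\rho(x),y),&\text{if }\eta(v)=\rho(v)\text{ for all }v\ne x\text{ and }\eta(x)=y,\\0,&\text{otherwise.}\end{cases}$$ Trees and unicycles: $\mathsf{TREE}_x(G)$ is the set of directed spanning trees of $G$ rooted at $x$, i.e. cycle-free spanning subgraphs $T$ of $G$ such that for every $y\ne x$ there is a unique directed path from $y$ to $x$ in $T$ (every vertex other than $x$ has exactly one outgoing edge in $T$, and $x$ has none). For a configuration $\rho$, $\rho\setminus x=\{(y,\rho(y)):y\in V\setminus\{x\}\}$. A spanning unicycle of $G$ is a spanning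 subgraph $U$ of $G$, with one outgoing edge at each vertex, containing exactly one directed cycle and such that from every vertex there is a unique path to this cycle; its $q$-weight is $\prod_{(y,z)\in U}q_y(z)$. The condition $\rho\setminus x\in\mathsf{TREE}_x(G)$ means that the edges $(v,\rho(v))$, $v\in V$, form a spanning unicycle whose cycle contains $x$.
   Formalization: In (2) the limit is taken along those n for which P(X_n=y)>0, since on a periodic graph the conditional probability can be undefined for infinitely many n; it is the ordinary limit whenever P(X_n=y)>0 for all large n. *)

(* Defs.v *)
From HB Require Import structures.
From mathcomp Require Import all_boot all_order all_algebra.
From mathcomp Require Import all_classical all_reals all_analysis.

Set Implicit Arguments.
Unset Strict Implicit.
Unset Printing Implicit Defensive.

Import Order.TTheory GRing.Theory Num.Theory.
Import numFieldNormedType.Exports.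

Local Open Scope ring_scope.

Section Graph.
Variables (V : finType) (e : rel V).

(* N_x, the state space of the local chain at x. *)
Definition nbr (x : V) : finType := {y : V | e x y}.

(* rho : V -> V with rho(x) in N_x; dffun makes the state space of the total
   chain a finType. *)
Definition config : finType := {dffun forall x : V, nbr x}.

Definition edge_rel (T : {set V * V}) : rel V := fun y z => (y, z) \in T.

(* In "path r y p" the starting vertex y is not listed in p; the empty p is the
   trivial path.  "cycle r [::]" holds by convention, whence "c = [::]" below. *)
Definition rooted_spanning_tree (x : V) (T : {set V * V}) : Prop :=
  [/\ forall y z, (y, z) \in T -> e y z,
      forall c : seq V, cycle (edge_rel T) c -> c = [::] &
      forall y, y != x ->
        exists! p : seq V, path (edge_rel T) y p /\ last y p = x].

Definition TREE (x : V) : {set {set V * V}} :=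
  [set T : {set V * V} | `[< rooted_spanning_tree x T >]]%SET.

Definition config_minus (rho : config) (x : V) : {set V * V} :=
  [set (y, val (rho y)) | y in [set~ x]]%SET.

End Graph.

Section FiniteKernels.
Variables (R : realType) (S : finType).
Implicit Types K : S -> S -> R.

Definition stochastic K : Prop :=
  (forall s t, 0 <= K s t) /\ (forall s, \sum_(t : S) K s t = 1).

Definition stationary_distribution K (pi : S -> R) : Prop :=
  [/\ forall s, 0 <= pi s,
      \sum_(s : S) pi s = 1 &
      forall t, \sum_(s : S) pi s * K s t = pi t].

Local Open Scope classical_set_scope.

(* P(Z_{n+1} = s_{n+1} | Z_0 = s_0, ..., Z_n = s_n) = K(s_n, s_{n+1}) in product
   form, so that conditioning events of probability 0 impose nothing.  The law
   of Z_0 is arbitrary. *)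
Definition markov_chain d (T : measurableType d) (P : probability T R)
    (Z : nat -> T -> S) K : Prop :=
  (forall n s, measurable (Z n @^-1` [set s])) /\
  (forall n (s : nat -> S),
     P [set w | forall i, (i <= n.+1)%N -> Z i w = s i] =
     (P [set w | forall i, (i <= n)%N -> Z i w = s i]
       * (K (s n) (s n.+1))%:E)%E).

End FiniteKernels.

Section TotalChain.
Variables (R : realType) (V : finType) (e : rel V).

Definition total_kernel (m : forall x : V, nbr e x -> nbr e x -> R)
    (s t : V * config e) : R :=
  let: (x, rho) := s in let: (y, eta) := t in
  if [forall v, (v != x) ==> (eta v == rho v)] && (val (eta x) == y)
  then m x (rho x) (eta x) else 0.

Definition partition_constant (q : V -> V -> R) : R :=
  \sum_(x : V) \sum_(T in TREE e x) \prod_(yz in T) q yz.1 yz.2.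

Definition unicycle_measure (q : V -> V -> R) (s : V * config e) : R :=
  let: (x, rho) := s in
  if config_minus rho x \in TREE e x
  then (partition_constant q)^-1 * \prod_(y : V) q y (val (rho y)) else 0.

End TotalChain.

Section Walk.
Variables (R : realType) (V : finType) (e : rel V).
Variables (d : measure_display) (T : measurableType d) (P : probability T R).
Variables (X : nat -> T -> V) (rho0 : T -> config e).

Local Open Scope classical_set_scope.

(* rho_n(x): the vertex reached at the last exit from x before time n, and
   rho_0(x) if there was none.  The default value of insubd is never used when
   X moves along edges. *)
Fixpoint last_exits (n : nat) (w : T) : config e :=
  if n is k.+1 then
    [ffun x : V => if X k w == x then insubd (last_exits k w x) (X k.+1 w)
                   else last_exits k w x]
  else rho0 w.

Definition total_chain (n : nat) (w : T) : V * config e :=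
  (X n w, last_exits n w).

(* The exit from x at its (k+1)-st visit is to z. *)
Definition exits_to (x : V) (k : nat) (w : T) (z : nbr e x) : Prop :=
  exists n : nat, [/\ X n w = x,
                      (\sum_(i < n) (X i w == x))%N = k &
                      X n.+1 w = val z].

(* Initial state followed by the successive exits from x.  The default value of
   xget serves only for trajectories that visit x finitely often. *)
Definition local_chain (x : V) (k : nat) (w : T) : nbr e x :=
  if k is j.+1 then xget (rho0 w x) [set z | exits_to j w z] else rho0 w x.

(* X_0 and the initial states rho_0 of the local chains are arbitrary, possibly
   random and dependent.  lmw_local alone would not determine the joint
   behaviour of the local chains; lmw_total says that each step uses the local
   chain at the current position independently of the rest of the past. *)
Record locally_markov_walk (m : forall x : V, nbr e x -> nbr e x -> R) : Prop :=
  LocallyMarkovWalk {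
    lmw_edge : forall n w, e (X n w) (X n.+1 w);
    lmw_local : forall x, markov_chain P (local_chain x) (m x);
    lmw_total : markov_chain P total_chain (total_kernel m)
  }.

End Walk.

Definition cond_prob (R : realType) (d : measure_display) (T : measurableType d)
    (P : probability T R) (A B : set T) : R :=
  fine (P (A `&` B)%classic) / fine (P B).

(* Main.v *)
(* Stationarity of mu: the predecessors of (y, eta) are the pairs (x, rho) with
   eta(x) = y and rho = eta off x.  Summing mu over rho(x) and using q_x M_x = q_x
   gives prod_v q_v(eta(v)) / Z for every x preceding y with eta \ x a tree; when
   eta \ y is a tree there is exactly one such x, the predecessor of y on the
   cycle of eta, and otherwise there is none.

   Mixing: after a walk that exits every vertex, the configuration depends on the
   path only, not on the initial configuration.  Boolean powers of the adjacency
   matrix are eventually periodic with some period p, and reachability in p steps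
   is an equivalence relation whose classes are the cyclic classes of the graph.
   Hence all states of a cyclic class can be driven to a common state in the same
   number of steps (Doeblin's condition), without any aperiodicity assumption.

   For (2), take f(s) = [X = y] (P_s(X_1 = x) - q_y(x)), which has mu-mean 0.  Both
   E_s f(X_n, rho_n) and P_s(X_n = y) vanish unless y is reachable in n steps from
   s; on that cyclic class the first tends uniformly to 0 and the second is bounded
   below, so the quotient P(X_(n+1) = x | X_n = y) - q_y(x) tends to 0. *)
Require Import Defs.
From mathcomp Require Import all_boot all_order all_algebra.
From mathcomp Require Import all_classical all_reals all_analysis.
From mathcomp Require Import zify ring lra.
Import Order.TTheory GRing.Theory Num.Theory.
Import numFieldNormedType.Exports.
Local Open Scope classical_set_scope.
Local Open Scope ring_scope.

Set Implicit Arguments.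
Unset Strict Implicit.
Unset Printing Implicit Defensive.

(** * Walks of a given length in a finite relation *)

Section Reachability.
Variables (T : finType) (r : rel T).

Fixpoint nreach (n : nat) (x y : T) : bool :=
  if n is k.+1 then [exists z, nreach k x z && r z y] else x == y.

Lemma nreachD m n x y z :
  nreach m x y -> nreach n y z -> nreach (m + n) x z.
Proof.
move=> xy; elim: n z => [|n IHn] z /=; first by move=> /eqP <-; rewrite addn0.
move=> /existsP[w /andP[yw wz]]; rewrite addnS /=.
by apply/existsP; exists w; rewrite IHn.
Qed.

Lemma nreach1 x y : r x y -> nreach 1 x y.
Proof. by move=> rxy; apply/existsP; exists x; rewrite /= eqxx. Qed.

Lemma nreachSl n x y :
  nreach n.+1 x y -> exists2 z, r x z & nreach n z y.
Proof.
elim: n y => [|n IHn] y.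
  by move=> /existsP[z /= /andP[/eqP-> rzy]]; exists y.
move=> /existsP[w /andP[/IHn[z rxz zw] rwy]]; exists z => //.
by apply/existsP; exists w; apply/andP.
Qed.

Lemma nreach_path x p : path r x p -> nreach (size p) x (last x p).
Proof.
elim: p x => [|y p IHp] x /=; first by rewrite eqxx.
by move=> /andP[rxy /IHp]; apply: (@nreachD 1); apply: nreach1.
Qed.

Lemma nreach_loop k n x : nreach n x x -> nreach (k * n) x x.
Proof.
by move=> xx; elim: k => [|k IHk]; rewrite ?mulSn /= ?eqxx //; apply: nreachD IHk.
Qed.

(* The Boolean powers of r take finitely many values. *)
Lemma nreach_eventually_periodic :
  exists2 p, (0 < p)%N & forall n x y, (p <= n)%N ->
    nreach (n + p) x y = nreach n x y.
Proof.
pose F (A : {ffun T * T -> bool}) : {ffun T * T -> bool} :=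
  [ffun xy => [exists z, A (xy.1, z) && r z xy.2]].
pose A0 : {ffun T * T -> bool} := [ffun xy => xy.1 == xy.2].
have iterE n x y : iter n F A0 (x, y) = nreach n x y.
  elim: n x y => [|n IHn] x y /=; rewrite ffunE //=.
  by apply: eq_existsb => z; rewrite IHn.
have /trajectP[i lt_i eq_i] := looping_order F A0.
set j := fingraph.order F A0 in lt_i eq_i.
pose c := (j - i)%N.
have c_gt0 : (0 < c)%N by rewrite subn_gt0.
have perc n : (i <= n)%N -> iter (n + c) F A0 = iter n F A0.
  move=> le_in; have -> : (n + c = n - i + j)%N by rewrite /c; lia.
  by rewrite iterD eq_i -iterD subnK.
have perk k n : (i <= n)%N -> iter (n + k * c) F A0 = iter n F A0.
  move=> le_in; elim: k => [|k IHk]; first by rewrite addn0.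
  by rewrite mulSnr addnA perc ?IHk // (leq_trans le_in) ?leq_addr.
(* This multiple of the period [c] exceeds the preperiod [i], so one number serves both as period
   and as threshold. *)
exists (i.+1 * c)%N; first by rewrite muln_gt0.
move=> n x y le_n; rewrite -!iterE perk //; apply: leq_trans le_n.
by rewrite (leq_trans (leqnSn i)) // leq_pmulr.
Qed.

End Reachability.

(** * Cyclic classes of a strongly connected graph *)

Section CyclicClasses.
Variables (V : finType) (e : rel V).
Hypothesis e_strong : forall x y : V, connect e x y.
Hypothesis e_out : forall x : V, exists y, e x y.

Lemma strong_nreach x y : exists2 n, (0 < n)%N & nreach e n x y.
Proof.
have [z exz] := e_out x.
have /connectP[p pth ->] := e_strong z y.
by exists (size (z :: p)) => //; apply: (@nreach_path _ _ x (z :: p)); rewrite /= exz.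
Qed.

Variable p : nat.
Hypothesis p_gt0 : (0 < p)%N.
Hypothesis p_per : forall n x y, (p <= n)%N ->
  nreach e (n + p) x y = nreach e n x y.

Lemma nreach_period_mul k n x y : (p <= n)%N ->
  nreach e (n + k * p) x y = nreach e n x y.
Proof.
move=> le_pn; elim: k => [|k IHk]; first by rewrite addn0.
by rewrite mulSnr addnA p_per ?IHk // (leq_trans le_pn) ?leq_addr.
Qed.

Lemma nreach_period n x y :
  (0 < n)%N -> nreach e n x x -> nreach e n x y -> nreach e p x y.
Proof.
move=> n_gt0 xx xy; rewrite -(nreach_period_mul n.-1) //.
have -> : (p + n.-1 * p = p.-1 * n + n)%N by nia.
by apply: nreachD xy; apply: nreach_loop.
Qed.

(** A walk from [y] back to [x'] turns the two walks into a walk from [x] to [x'] and a loop at [x']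
    of the same length; loops are then added as in [nreach_period], at the far end this time. *)
Lemma nreach_reach n x x' y :
  nreach e n x y -> nreach e n x' y -> nreach e p x x'.
Proof.
move=> xy x'y; have [j j_gt0 yx'] := strong_nreach y x'.
have pos : (0 < p * (n + j))%N by rewrite muln_gt0 p_gt0 addn_gt0 j_gt0 orbT.
have x'x' : nreach e (n + j) x' x' := nreachD x'y yx'.
have xx' : nreach e (n + j) x x' := nreachD xy yx'.
rewrite -(nreach_period_mul (n + j).-1) //.
have -> : (p + (n + j).-1 * p = (n + j) + p.-1 * (n + j))%N by nia.
by apply: nreachD xx' _; apply: nreach_loop.
Qed.

(** Reachability in [p] steps is symmetric by [nreach_reach], so a detour from [x'] to [x] costs [p]
    steps, which periodicity removes. *)
Lemma nreach_target n x x' y : (p <= n)%N ->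
  nreach e n x y -> nreach e p x x' -> nreach e n x' y.
Proof.
move=> le_pn xy xx'; rewrite -p_per // addnC; apply: nreachD xy.
have [j j_gt0 x'x'] := strong_nreach x' x'.
apply: (@nreach_reach p _ _ x') => //.
by apply: (nreach_period j_gt0 x'x').
Qed.

(* Two successors of the same vertex lie in the same cyclic class. *)
Lemma nreach_successor n x x' y : (p <= n)%N ->
  nreach e n.+1 x y -> e x x' -> nreach e n x' y.
Proof.
move=> le_pn /nreachSl[x'' exx'' x''y] exx'; apply: nreach_target x''y _ => //.
have [j j_gt0 x''x] := strong_nreach x'' x.
apply: (@nreach_period (j + 1)); first by rewrite addn1.
  by apply: nreachD x''x _; apply: nreach1.
by apply: nreachD x''x _; apply: nreach1.
Qed.

End CyclicClasses.

Lemma positive_lower_bound (R : realType) (I : finType) (F : I -> R) :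
  exists2 c : R, 0 < c <= 1 & forall i, 0 < F i -> c <= F i.
Proof.
exists (\big[Num.min/1]_(i | 0 < F i) F i); last first.
  by move=> i Fi; apply: bigmin_le_cond.
apply/andP; split; last exact: bigmin_le_id.
by elim/big_ind: _ => // a b a0 b0; rewrite lt_min a0.
Qed.

(** * Finite Markov kernels as operators on functions *)

Section MarkovOperator.
Variables (R : realType) (S : finType) (K : S -> S -> R).
Hypothesis K_stoch : stochastic K.
Implicit Types (f g : S -> R) (D : pred S).

(** Conditional expectation: [iter n Mop f s] is the mean of [f] after [n] steps from [s]. *)
Definition Mop f : S -> R := fun s => \sum_t K s t * f t.

Definition ind D : S -> R := fun s => (D s)%:R.

Lemma ind_in D s : D s -> ind D s = 1.
Proof. by rewrite /ind => ->. Qed.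

Lemma ind_out D s : ~~ D s -> ind D s = 0.
Proof. by rewrite /ind => /negPf->. Qed.

Let K_ge0 s t : 0 <= K s t. Proof. exact: K_stoch.1. Qed.

Lemma Mop_lin a b f g s :
  Mop (fun t => a * f t + b * g t) s = a * Mop f s + b * Mop g s.
Proof.
rewrite /Mop !mulr_sumr -big_split /=; apply: eq_bigr => t _; ring.
Qed.

Lemma iter_Mop_lin n a b f g s :
  iter n Mop (fun t => a * f t + b * g t) s =
  a * iter n Mop f s + b * iter n Mop g s.
Proof.
elim: n s => //= n IHn s; rewrite -Mop_lin.
by congr (Mop _ s); apply/funext => t; exact: IHn.
Qed.

Lemma Mop_ge0 f : (forall s, 0 <= f s) -> forall s, 0 <= Mop f s.
Proof. by move=> f0 s; apply: sumr_ge0 => t _; rewrite mulr_ge0. Qed.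

Lemma iter_Mop_ge0 n f : (forall s, 0 <= f s) -> forall s, 0 <= iter n Mop f s.
Proof. by move=> f0; elim: n => //= n IHn; apply: Mop_ge0. Qed.

Lemma Mop_le f g : (forall s, f s <= g s) -> forall s, Mop f s <= Mop g s.
Proof. by move=> fg s; apply: ler_sum => t _; rewrite ler_wpM2l. Qed.

Lemma iter_Mop_le n f g :
  (forall s, f s <= g s) -> forall s, iter n Mop f s <= iter n Mop g s.
Proof. by move=> fg; elim: n => //= n IHn; apply: Mop_le. Qed.

(** A single walk of length [n] from [s] to [t] already has probability at least [c ^+ n]. *)
Lemma iter_Mop_minor c : 0 <= c -> (forall s t, 0 < K s t -> c <= K s t) ->
  forall n s t, nreach (fun u v => 0 < K u v) n s t ->
  forall f, (forall u, 0 <= f u) -> c ^+ n * f t <= iter n Mop f s.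
Proof.
move=> c_ge0 cK; elim=> [|n IHn] s t.
  by move=> /eqP <- f _; rewrite expr0 mul1r.
move=> /nreachSl[u su ut] f f_ge0; rewrite iterS exprS -mulrA.
apply: (@le_trans _ _ (K s u * iter n Mop f u)).
  by rewrite ler_pM ?cK ?IHn // mulr_ge0 ?exprn_ge0.
rewrite /Mop (bigD1 u) //= lerDl sumr_ge0 // => v _.
by rewrite mulr_ge0 // iter_Mop_ge0.
Qed.

Lemma Mop_ind_eq1 D s : (forall t, 0 < K s t -> D t) -> Mop (ind D) s = 1.
Proof.
move=> DP; rewrite -(K_stoch.2 s); apply: eq_bigr => t _; rewrite /ind.
have := K_ge0 s t; rewrite le0r => /orP[/eqP->|/DP->]; first by rewrite mul0r.
by rewrite mulr1.
Qed.

Lemma Mop_ind_eq0 D s : (forall t, 0 < K s t -> ~~ D t) -> Mop (ind D) s = 0.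
Proof.
move=> DP; rewrite /Mop big1 // => t _; rewrite /ind.
have := K_ge0 s t; rewrite le0r => /orP[/eqP->|/DP/negPf->].
  by rewrite mul0r.
by rewrite mulr0.
Qed.

(** * Contraction of the oscillation under Doeblin's condition *)

Section Doeblin.
Variables (D : nat -> pred S) (p N : nat) (c : R).
Hypothesis c01 : 0 < c <= 1.
Hypothesis D_step : forall n, (p <= n)%N ->
  forall s, Mop (ind (D n)) s = ind (D n.+1) s.
Hypothesis D_minor : forall n, (p <= n)%N -> exists2 t, D n t &
  forall s, D (n + N)%N s -> forall g, (forall u, 0 <= g u) ->
  c * g t <= iter N Mop g s.

Lemma iter_Mop_ind k n : (p <= n)%N ->
  forall s, iter k Mop (ind (D n)) s = ind (D (n + k)) s.
Proof.
move=> le_pn; elim: k => [|k IHk] s; first by rewrite addn0.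
rewrite iterS addnS -D_step ?(leq_trans le_pn) ?leq_addr //.
by congr (Mop _ s); apply/funext.
Qed.

(** Besides bounding the oscillation on [D n] by [w], this forces [f] to vanish off [D n]. *)
Definition osc_le (n : nat) (w : R) f := exists a, forall s,
  a * ind (D n) s <= f s <= (a + w) * ind (D n) s.

(** If [h t] lies in the upper half of the interval, the minorization at [t] lifts the lower end by
    [c * w / 2]; otherwise it lowers the upper end by as much. *)
Lemma osc_le_contract n w h : (p <= n)%N -> osc_le n w h ->
  osc_le (n + N) ((1 - c / 2) * w) (iter N Mop h).
Proof.
move=> le_pn [a ah]; have [t Dt minor] := D_minor le_pn.
have lo s : 0 <= -a * ind (D n) s + 1 * h s.
  by have /andP[h1 _] := ah s; lra.
have hi s : 0 <= (a + w) * ind (D n) s + (-1) * h s.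
  by have /andP[_ h1] := ah s; lra.
have lo' s := iter_Mop_ge0 N lo s; have hi' s := iter_Mop_ge0 N hi s.
have mlo s Ds := minor s Ds _ lo; have mhi s Ds := minor s Ds _ hi.
have iE s : iter N Mop (ind (D n)) s = ind (D (n + N)) s by rewrite iter_Mop_ind.
have [ht|ht] := leP (a + w / 2) (h t).
- exists (a + c * w / 2) => s; have [Ds|Ds] := boolP (D (n + N)%N s).
    have := mlo s Ds; have := hi' s; rewrite !iter_Mop_lin iE (ind_in Ds) (ind_in Dt).
    move: (iter _ _ _ _) (h t) ht => z y yh h1 h2.
    have cy : c * (a + w / 2) <= c * y by rewrite ler_wpM2l //; case/andP: c01 => /ltW.
    by apply/andP; split; lra.
  have := lo' s; have := hi' s; rewrite !iter_Mop_lin iE (ind_out Ds).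
  by move=> h1 h2; apply/andP; split; lra.
- exists a => s; have [Ds|Ds] := boolP (D (n + N)%N s).
    have := mhi s Ds; have := lo' s; rewrite !iter_Mop_lin iE (ind_in Ds) (ind_in Dt).
    move: (iter _ _ _ _) (h t) ht => z y yh h1 h2.
    have cy : c * y <= c * (a + w / 2).
      by rewrite ler_wpM2l ?ltW //; case/andP: c01.
    by apply/andP; split; lra.
  have := lo' s; have := hi' s; rewrite !iter_Mop_lin iE (ind_out Ds).
  by move=> h1 h2; apply/andP; split; lra.
Qed.

Lemma osc_le_iter w0 f : (forall n, (p <= n)%N -> osc_le n w0 (iter n Mop f)) ->
  forall k n, (p + k * N <= n)%N ->
  osc_le n ((1 - c / 2) ^+ k * w0) (iter n Mop f).
Proof.
move=> base; elim=> [|k IHk] n le_n.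
  by rewrite expr0 mul1r; apply: base; rewrite addn0 in le_n.
have nE : (n = (n - N) + N)%N by rewrite mulSn in le_n; lia.
rewrite nE {2}addnC iterD exprS -mulrA; apply: osc_le_contract.
  by rewrite mulSn in le_n; lia.
by apply: IHk; rewrite mulSn in le_n; lia.
Qed.

Lemma osc_le_small w0 f : (forall n, (p <= n)%N -> osc_le n w0 (iter n Mop f)) ->
  0 <= w0 -> forall eta : R, 0 < eta -> exists m, forall n, (m <= n)%N ->
  exists2 w, w <= eta & osc_le n w (iter n Mop f).
Proof.
move=> base w0_ge0 eta eta_gt0; case/andP: c01 => c_gt0 c_le1.
have ratio : `|1 - c / 2| < 1 by rewrite ger0_norm; lra.
have /cvgrPdist_le /(_ _ eta_gt0) [k _ Hk] :
    ((fun k => (1 - c / 2) ^+ k * w0) @ \oo --> (0 : R)).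
  by rewrite -(mul0r w0); apply: cvgM; [exact: cvg_expr|exact: cvg_cst].
exists (p + k * N)%N => n le_n; exists ((1 - c / 2) ^+ k * w0); last exact: osc_le_iter.
have := Hk k (leqnn k); rewrite /= sub0r normrN => h.
by apply: le_trans h; exact: ler_norm.
Qed.

End Doeblin.

(** * Uniqueness of the stationary distribution *)

Section Stationary.

Lemma stationary_sum_iter (pi : S -> R) f n :
  (forall t, \sum_s pi s * K s t = pi t) ->
  \sum_s pi s * iter n Mop f s = \sum_s pi s * f s.
Proof.
move=> st; elim: n => //= n <-.
transitivity (\sum_t \sum_s pi s * K s t * iter n Mop f t); last first.
  by apply: eq_bigr => t _; rewrite -mulr_suml st.
rewrite exchange_big /=; apply: eq_bigr => s _.
by rewrite /Mop mulr_sumr; apply: eq_bigr => t _; rewrite mulrA.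
Qed.

Lemma nonneg_invariant_reach (pi : S -> R) n s t :
  (forall u, 0 <= pi u) -> (forall u, \sum_v pi v * K v u = pi u) ->
  nreach (fun u v => 0 < K u v) n s t -> 0 < pi s -> 0 < pi t.
Proof.
move=> pi0 st; elim: n t => [|n IHn] t; first by move=> /eqP->.
move=> /existsP[u /andP[su ut]] /(IHn _ su) piu.
rewrite -st (bigD1 u) //= ltr_pwDl ?mulr_gt0 ?sumr_ge0 // => v _.
by rewrite mulr_ge0.
Qed.

(* The positive and negative parts of an invariant signed measure are both
   invariant; since both charge a state reachable from everywhere, one of them
   vanishes. *)
Lemma stationary_unique t0 (mu nu : S -> R) :
  (forall s, exists n, nreach (fun u v => 0 < K u v) n s t0) ->
  stationary_distribution K mu -> stationary_distribution K nu -> nu =1 mu.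
Proof.
move=> reach [mu0 mu1 muK] [nu0 nu1 nuK].
pose dl s := nu s - mu s.
have dlK t : \sum_s dl s * K s t = dl t.
  rewrite /dl -nuK -muK -sumrB; apply: eq_bigr => s _; ring.
have dl0 : \sum_s dl s = 0 by rewrite sumrB nu1 mu1 subrr.
have le_abs t : `|dl t| <= \sum_s `|dl s| * K s t.
  rewrite -{1}dlK (le_trans (ler_norm_sum _ _ _)) // ler_sum // => s _.
  by rewrite normrM (ger0_norm (K_ge0 _ _)).
(* Both sides of [le_abs] have the same sum over [t], hence agree everywhere. *)
have absK t : \sum_s `|dl s| * K s t = `|dl t|.
  apply/eqP; rewrite -subr_eq0; move: t; apply/forallP.
  have : \sum_t (\sum_s `|dl s| * K s t - `|dl t|) = 0.
    rewrite sumrB exchange_big /=; apply/eqP; rewrite subr_eq0; apply/eqP.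
    by apply: eq_bigr => s _; rewrite -mulr_sumr K_stoch.2 mulr1.
  move=> /eqP; rewrite psumr_eq0; last by move=> t _; rewrite subr_ge0.
  by move=> /allP h; apply/forallP => t; apply: h; rewrite mem_index_enum.
pose pp s := `|dl s| + dl s; pose nn s := `|dl s| - dl s.
have pp0 s : 0 <= pp s by rewrite /pp -lerBlDr sub0r -normrN ler_norm.
have nn0 s : 0 <= nn s by rewrite /nn subr_ge0 ler_norm.
have ppK t : \sum_s pp s * K s t = pp t.
  by rewrite /pp -absK -dlK -big_split; apply: eq_bigr => s _; rewrite mulrDl.
have nnK t : \sum_s nn s * K s t = nn t.
  by rewrite /nn -absK -dlK -sumrB; apply: eq_bigr => s _; rewrite mulrBl.
have null (g : S -> R) : (forall s, 0 <= g s) -> (forall t, \sum_s g s * K s t = g t) ->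
    g t0 = 0 -> forall s, g s = 0.
  move=> g0 gK gt0 s; apply/eqP; apply: contraT => gs.
  have [n st] := reach s.
  have := nonneg_invariant_reach g0 gK st.
  by rewrite gt0 ltxx lt_neqAle eq_sym gs g0 => /(_ isT).
have zero (g : S -> R) : (forall s, 0 <= g s) -> \sum_s g s = 0 -> forall s, g s = 0.
  move=> g0 /eqP; rewrite psumr_eq0 => [/allP h s|s _]; last exact: g0.
  by apply/eqP; apply: h; rewrite mem_index_enum.
suff dl_eq0 s : dl s = 0 by move=> s; apply/eqP; rewrite -subr_eq0 -/(dl s) dl_eq0.
(* The sign of [dl t0] decides which part vanishes at [t0], hence everywhere; then [dl] has constant
   sign and sum 0. *)
have [dt|dt] := leP (dl t0) 0.
- have ppz := null pp pp0 ppK _; have {}ppz u : pp u = 0.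
    by apply: ppz; rewrite /pp ler0_norm // addNr.
  apply/eqP; rewrite -oppr_eq0; apply/eqP.
  apply: (zero (fun u => - dl u)) => [u|]; last by rewrite sumrN dl0 oppr0.
  by move: (normr_ge0 (dl u)) (ppz u); rewrite /pp; move: `|dl u| => a; lra.
- have nnz := null nn nn0 nnK _; have {}nnz u : nn u = 0.
    by apply: nnz; rewrite /nn gtr0_norm // subrr.
  apply: (zero dl) => // u.
  by move: (normr_ge0 (dl u)) (nnz u); rewrite /nn; move: `|dl u| => a; lra.
Qed.

End Stationary.
End MarkovOperator.

(** * Configurations and rooted spanning trees *)

Section Configurations.
Variables (V : finType) (e : rel V).
Implicit Types (rho eta : config e) (x y v : V).

Definition cfg_step rho v : V := val (rho v).

Definition upd rho x (z : nbr e x) : config e := [ffun v => eqtype.dfwith rho z v].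

Lemma upd_in rho x (z : nbr e x) : upd rho z x = z.
Proof. by rewrite ffunE dfwith_in. Qed.

Lemma upd_out rho x (z : nbr e x) v : v != x -> upd rho z v = rho v.
Proof. by move=> vx; rewrite ffunE dfwith_out // eq_sym. Qed.

Definition agree_off x rho eta := [forall v, (v != x) ==> (eta v == rho v)].

Lemma sum_agree_off (R : nmodType) x rho (F : config e -> R) :
  \sum_(eta | agree_off x rho eta) F eta = \sum_(z : nbr e x) F (upd rho z).
Proof.
rewrite (reindex_onto (fun z : nbr e x => upd rho z) (fun eta => eta x)) /=.
  apply: eq_bigl => z; rewrite upd_in eqxx andbT.
  by apply/forallP => v; apply/implyP => vx; rewrite upd_out.
move=> eta /forallP h; apply/ffunP => v; have [->|vx] := eqVneq v x.
  by rewrite upd_in.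
by rewrite upd_out //; have := h v; rewrite vx => /eqP.
Qed.

Lemma path_config_minus rho x y p :
  path (edge_rel (config_minus rho x)) y p -> fpath (cfg_step rho) y p.
Proof.
apply: sub_path => a b /imsetP[c _ [-> ->]]; exact: eqxx.
Qed.

Lemma config_minus_edge rho x a b :
  ((a, b) \in config_minus rho x) = (a != x) && (cfg_step rho a == b).
Proof.
apply/imsetP/andP => [[c]|[ax /eqP<-]].
  by rewrite !inE => cx [-> ->].
by exists a; rewrite ?inE.
Qed.

(** Off [x] the edges are the graph of the function [cfg_step rho], which makes paths to [x] unique.
    A cycle cannot contain [x], so its vertices would never reach [x]. *)
Lemma TREE_config_minusP rho x :
  reflect (forall v, fconnect (cfg_step rho) v x) (config_minus rho x \in TREE e x).
Proof.
rewrite inE; apply: (iffP (asboolP _)).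
  move=> [_ _ tree] v; have [->|vx] := eqVneq v x; first exact: connect0.
  have [p [[pth <-] _]] := tree v vx.
  by apply/connectP; exists p => //; apply: path_config_minus pth.
move=> conn; split.
- by move=> y z; rewrite config_minus_edge => /andP[_ /eqP<-]; exact: valP.
- case=> // a c cyc.
  have xc : x \notin a :: c.
    apply/negP => /(next_cycle cyc).
    by rewrite /edge_rel config_minus_edge eqxx.
  have fcyc : fcycle (cfg_step rho) (a :: c) by apply: path_config_minus cyc.
  by have := conn a; rewrite (fconnect_cycle fcyc) ?mem_head // (negPf xc).
- move=> y _.
  have [p [pth lp]] : exists p, path (edge_rel (config_minus rho x)) y p /\ last y p = x.
    have := conn y; rewrite -[fconnect _ _ _]/(connect _ _ _) => /iter_findex.
    move: (findex _ _ _) => k; elim: k y => [|k IHk] y.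
      by move=> /= yx; exists [::].
    rewrite iterSr => /IHk[p [pth lp]].
    (* The path is cut at [x], which has no outgoing edge in [config_minus rho x]. *)
    have [yx|yx] := eqVneq y x; first by exists [::].
    exists (cfg_step rho y :: p); split=> //=.
    by rewrite /edge_rel config_minus_edge yx eqxx.
  exists p; split=> // p' [pth' lp'].
  elim: p y p' pth lp pth' lp' => [|a p IHp] y [|b p'] //=.
  + by move=> _ ->; rewrite /edge_rel config_minus_edge eqxx.
  + by move=> + _ _ yx; rewrite {1}/edge_rel config_minus_edge yx eqxx.
  rewrite {1 3}/edge_rel !config_minus_edge.
  move=> /andP[/andP[_ /eqP <-] pth] lp /andP[/andP[_ /eqP <-] pth'] lp'.
  by congr cons; apply: IHp pth lp pth' lp'.
Qed.

(** A vertex other than [x] has an outgoing edge, the first of its path to [x], and only one, since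
    two would give two such paths; an edge leaving [x] would close a cycle. The exit at [x] is left
    to [rho0]. *)
Lemma TREE_config (rho0 : config e) x T :
  T \in TREE e x -> exists rho, T = config_minus rho x.
Proof.
rewrite inE => /asboolP[Te Tcyc Tpath].
pose rho : config e := [ffun y : V =>
  if [pick z : nbr e y | (y, val z) \in T] is Some z then z else rho0 y].
have path_x y : exists p, path (edge_rel T) y p /\ last y p = x.
  have [->|/Tpath[p [pp _]]] := eqVneq y x; last by exists p.
  by exists [::].
have rooted z : (x, z) \notin T.
  apply/negP => xz; have [p [pth lp]] := path_x z.
  have : cycle (edge_rel T) (z :: p).
    by rewrite /= rcons_path pth lp.
  by move=> /Tcyc.
have outdeg y z z' : (y, z) \in T -> (y, z') \in T -> z = z'.
  move=> yz yz'; have yx : y != x.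
    by apply: contraTneq yz => ->; exact: rooted.
  have [p [pth lp]] := path_x z; have [p' [pth' lp']] := path_x z'.
  have [p0 [_ uniq_p0]] := Tpath y yx.
  have := uniq_p0 (z' :: p'); rewrite (uniq_p0 (z :: p)) => [|/=].
    by rewrite /= {1}/edge_rel yz' => /(_ (conj pth' lp')) [].
  by rewrite {1}/edge_rel yz.
exists rho; apply/setP => -[a b]; rewrite config_minus_edge /cfg_step ffunE.
have [->|ax] := eqVneq a x; first by rewrite (negPf (rooted b)).
case: pickP => [z az|no]; last first.
  have [[|z p] [pth lp]] := path_x a; first by rewrite -lp eqxx in ax.
  move: pth => /= /andP[az _].
  by have := no (exist _ z (Te _ _ az)); rewrite /= [X in X = _]az.
by apply/idP/eqP => [/(outdeg _ _ _ az)|<-].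
Qed.

(** As [y] is reached from its own image, it lies on the cycle. The vertex sought is its predecessor
    there, unique since [cfg_step rho] is injective on the orbit of [y], which contains every
    candidate. *)
Lemma TREE_root_unique rho y : (forall v, fconnect (cfg_step rho) v y) ->
  exists! x, cfg_step rho x = y /\ forall v, fconnect (cfg_step rho) v x.
Proof.
move=> conn; set f := cfg_step rho in conn *.
(* Of these equivalent conditions, 2 says that [f y] leads to [y], 3 that a positive iterate fixes
   [y], 5 that [f] is injective on the orbit. *)
have cyc := @orbitPcycle _ f y.
have yfy : y \in fconnect f (f y) by apply: conn.
have inj : {in orbit f y &, injective f} by exact/(cyc 2%N 5%N).
have [k ky] : exists k, iter k.+1 f y = y by exact/(cyc 2%N 3%N).
exists (iter k f y); split.
  split=> // v; apply: connect_trans (conn v) _; exact: fconnect_iter.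
move=> x' [fx' conn']; apply: inj.
- by rewrite -fconnect_orbit; exact: fconnect_iter.
- by rewrite -fconnect_orbit; exact: conn'.
- by rewrite fx' -iterS.
Qed.

End Configurations.

(** * Weights of trees and of configurations *)

Section TreeWeights.
Variables (R : realType) (V : finType) (e : rel V) (q : V -> V -> R).
Implicit Types (rho eta : config e) (x y v : V).

Definition cfg_weight rho : R := \prod_v q v (val (rho v)).

Lemma config_minus_upd rho x (z : nbr e x) :
  config_minus (upd rho z) x = config_minus rho x.
Proof.
apply/setP => -[a b]; rewrite !config_minus_edge /cfg_step.
by have [//|ax] := eqVneq a x; rewrite upd_out.
Qed.

Lemma config_minus_agree rho eta x :
  (config_minus eta x == config_minus rho x) = agree_off x rho eta.
Proof.
apply/eqP/forallP => [h v|h].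
  apply/implyP => vx; apply/eqP/val_inj.
  have : (v, val (eta v)) \in config_minus eta x.
    by rewrite config_minus_edge vx eqxx.
  by rewrite h config_minus_edge vx => /eqP.
apply/setP => -[a b]; rewrite !config_minus_edge /cfg_step.
by have [//|ax] := eqVneq a x; have := h a; rewrite ax => /eqP ->.
Qed.

Lemma cfg_weight_upd rho x (z : nbr e x) :
  cfg_weight (upd rho z) = q x (val z) * \prod_(yz in config_minus rho x) q yz.1 yz.2.
Proof.
rewrite /cfg_weight (bigD1 x) //= upd_in; congr (_ * _).
rewrite /config_minus big_imset /=; last by move=> a b _ _ [].
apply: eq_big => [v|v vx]; first by rewrite !inE.
by rewrite upd_out.
Qed.

(* A configuration rooted at x is a tree rooted at x together with a free
   choice of the exit from x. *)
Lemma sum_tree_config (rho0 : config e) x (g : nbr e x -> R) :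
  \sum_(rho | config_minus rho x \in TREE e x) cfg_weight rho * g (rho x) =
  (\sum_(T in TREE e x) \prod_(yz in T) q yz.1 yz.2) *
    \sum_(z : nbr e x) q x (val z) * g z.
Proof.
rewrite (partition_big (fun rho => config_minus rho x) (mem (TREE e x))) //=.
rewrite mulr_suml; apply: eq_bigr => T TT.
have [rho1 TE] := TREE_config rho0 TT; rewrite {}TE in TT *.
rewrite (eq_bigl (agree_off x rho1)) => [|rho]; last first.
  by rewrite -config_minus_agree andbC; case: eqP => // ->.
rewrite sum_agree_off mulr_sumr; apply: eq_bigr => z _.
by rewrite cfg_weight_upd upd_in; ring.
Qed.

End TreeWeights.

(** * Existence of spanning trees *)

Section ShortestPathTree.
Variables (V : finType) (e : rel V).

(** With [d v] the distance from [v] to [x], each vertex other than [x] exits to a strictly closer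
    one, so iteration ends at [x]. *)
Lemma spanning_tree_exists (rho0 : config e) x :
  (forall v, exists n, nreach e n v x) ->
  exists rho : config e, config_minus rho x \in TREE e x.
Proof.
move=> reach; pose d v := ex_minn (reach v).
have closer v : v != x -> exists z : nbr e v, (d (val z) < d v)%N.
  move=> vx; rewrite {2}/d; case: ex_minnP => -[|k].
    by move=> /eqP vx'; rewrite vx' eqxx in vx.
  move=> /nreachSl[z vz zx] _; exists (exist _ z vz) => /=.
  by rewrite ltnS /d; case: ex_minnP => n _; apply.
pose rho : config e := [ffun v : V =>
  if [pick z : nbr e v | (d (val z) < d v)%N] is Some z then z else rho0 v].
have rhoP v : v != x -> (d (cfg_step rho v) < d v)%N.
  move=> /closer[z dz]; rewrite /cfg_step ffunE.
  by case: pickP => // /(_ z); rewrite dz.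
exists rho; apply/TREE_config_minusP => v.
have [n] := ubnP (d v); elim: n v => // n IHn v dv.
have [->|vx] := eqVneq v x; first exact: connect0.
apply: connect_trans (fconnect1 _ v) _; apply: IHn.
exact: leq_trans (rhoP v vx) dv.
Qed.

End ShortestPathTree.

(** * The transition kernel of the total chain *)

Section TotalKernel.
Variables (R : realType) (V : finType) (e : rel V).
Variable m : forall x : V, nbr e x -> nbr e x -> R.
Arguments m : clear implicits.
Hypothesis m_stochastic : forall x : V, stochastic (m x).
Implicit Types (rho eta : config e) (x y v : V).

Local Notation K := (total_kernel m).
Local Notation S := (V * config e)%type.

Lemma total_kernelE x rho y eta :
  K (x, rho) (y, eta) =
  if agree_off x rho eta && (val (eta x) == y) then m x (rho x) (eta x) else 0.
Proof. by []. Qed.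

Lemma Mop_total F x rho :
  Mop K F (x, rho) = \sum_(z : nbr e x) m x (rho x) z * F (val z, upd rho z).
Proof.
rewrite /Mop.
transitivity (\sum_y \sum_eta K (x, rho) (y, eta) * F (y, eta)).
  by rewrite pair_bigA /=; apply: eq_bigr => -[].
rewrite exchange_big /=.
transitivity (\sum_(eta | agree_off x rho eta)
    m x (rho x) (eta x) * F (val (eta x), eta)); last first.
  by rewrite sum_agree_off; apply: eq_bigr => z _; rewrite upd_in.
rewrite [RHS]big_mkcond; apply: eq_bigr => eta _.
rewrite (bigD1 (val (eta x))) //= eqxx andbT big1 => [|y yx].
  by rewrite addr0 -/(agree_off x rho eta); case: ifP; rewrite ?mul0r.
by rewrite eq_sym (negPf yx) andbF mul0r.
Qed.

Lemma total_kernel_ge0 s t : 0 <= K s t.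
Proof.
case: s t => [x rho] [y eta]; rewrite total_kernelE; case: ifP => // _.
exact: (m_stochastic x).1.
Qed.

Lemma total_kernel_stochastic : stochastic K.
Proof.
split=> [|[x rho]]; first exact: total_kernel_ge0.
have := Mop_total (fun=> 1) x rho; rewrite /Mop.
under eq_bigr do rewrite mulr1; move=> ->.
by under eq_bigr do rewrite mulr1; exact: (m_stochastic x).2.
Qed.

Lemma total_kernel_edge s t : 0 < K s t -> e s.1 t.1.
Proof.
case: s t => [x rho] [y eta]; rewrite total_kernelE.
case: ifP => [/andP[_ /eqP <-] _|_]; last by rewrite ltxx.
exact: valP.
Qed.

(** * Stationarity of the unicycle measure *)

Section Stationarity.
Variable q : V -> V -> R.
Hypothesis q_stationary : forall x : V,
  stationary_distribution (m x) (fun y : nbr e x => q x (val y)).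
Hypothesis q_pos : forall x y, e x y -> 0 < q x y.
Hypothesis trees : forall x, exists rho : config e, config_minus rho x \in TREE e x.

Local Notation mu := (unicycle_measure q : S -> R).

Lemma cfg_weight_gt0 rho : 0 < cfg_weight q rho.
Proof. by apply: prodr_gt0 => v _; apply: q_pos; exact: valP. Qed.

(** A configuration carries one factor more than its tree, that of the exit from [x], and this
    factor sums to 1. *)
Lemma partition_constantE (rho0 : config e) : partition_constant e q =
  \sum_x \sum_(rho : config e | config_minus rho x \in TREE e x) cfg_weight q rho.
Proof.
apply: eq_bigr => x _; have := sum_tree_config q rho0 (x := x) (fun=> 1).
under eq_bigr do rewrite mulr1; move=> ->.
under [X in _ * X]eq_bigr do rewrite mulr1.
by case: (q_stationary x) => _ -> _; rewrite mulr1.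
Qed.

Lemma partition_constant_gt0 x : 0 < partition_constant e q.
Proof.
have [rho rhoP] := trees x; rewrite (partition_constantE rho).
have W_ge0 eta : 0 <= cfg_weight q eta by rewrite ltW // cfg_weight_gt0.
rewrite (bigD1 x) //=; apply: ltr_pwDl; last first.
  by apply: sumr_ge0 => v _; apply: sumr_ge0 => eta _; exact: W_ge0.
rewrite (bigD1 rho) //=; apply: ltr_pwDl; first exact: cfg_weight_gt0.
by apply: sumr_ge0 => eta _; exact: W_ge0.
Qed.

Lemma unicycle_measure_gt0 x rho : config_minus rho x \in TREE e x -> 0 < mu (x, rho).
Proof.
move=> /= h; rewrite h mulr_gt0 ?invr_gt0 ?(partition_constant_gt0 x) //.
exact: cfg_weight_gt0.
Qed.

Lemma unicycle_stationary (x0 : V) : stationary_distribution K mu.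
Proof.
have Z_gt0 := partition_constant_gt0 x0; have [rho0 _] := trees x0.
split.
- move=> [x rho] /=; case: ifP => // h.
  by rewrite mulr_ge0 ?invr_ge0 ?ltW //; exact: cfg_weight_gt0.
- transitivity (\sum_x \sum_rho mu (x, rho)).
    by rewrite pair_bigA; apply: eq_bigr => -[].
  under eq_bigr do rewrite -big_mkcond -mulr_sumr /=.
  by rewrite -mulr_sumr -(partition_constantE rho0) mulVf // gt_eqF.
move=> [y eta].
transitivity (\sum_x \sum_rho mu (x, rho) * K (x, rho) (y, eta)).
  by rewrite pair_bigA; apply: eq_bigr => -[].
(* Previous positions that contribute to the mass at [(y, eta)], all by the same amount. *)
pose pre x := (cfg_step eta x == y) && (config_minus eta x \in TREE e x).
transitivity (\sum_(x | pre x) (partition_constant e q)^-1 * cfg_weight q eta).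
  rewrite [RHS]big_mkcond; apply: eq_bigr => x _.
  (* [agree_off] is symmetric in the two configurations, so the sum runs over the forgotten exit
     from [x]. *)
  transitivity (\sum_(rho | agree_off x eta rho)
      if val (eta x) == y then mu (x, rho) * m x (rho x) (eta x) else 0).
    rewrite [RHS]big_mkcond; apply: eq_bigr => rho _; rewrite total_kernelE.
    rewrite -!config_minus_agree eq_sym; case: eqP => _; case: eqP => _ //=;
    by rewrite mulr0.
  rewrite sum_agree_off /pre /cfg_step; case: eqP => /= _; last by rewrite big1.
  case: ifP => tree; last first.
    by rewrite big1 // => z _; rewrite config_minus_upd tree mul0r.
  transitivity (\sum_(z : nbr e x) (partition_constant e q)^-1 *
      (\prod_(yz in config_minus eta x) q yz.1 yz.2) *
      (q x (val z) * m x z (eta x))).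
    apply: eq_bigr => z _; rewrite config_minus_upd tree upd_in.
    by rewrite -/(cfg_weight q _) cfg_weight_upd; ring.
  (* Invariance of [q x] under [m x] sums out the forgotten exit. *)
  rewrite -mulr_sumr; have [_ _ ->] := q_stationary x.
  have updK : upd eta (eta x) = eta.
    apply/ffunP => v; have [->|vx] := eqVneq v x; first by rewrite upd_in.
    by rewrite upd_out.
  by rewrite -{3}updK cfg_weight_upd; ring.
rewrite /=; case: ifP => [/TREE_config_minusP conn|noty].
  have [x [[xy xconn] xuniq]] := TREE_root_unique conn.
  rewrite (big_pred1 x) // => x'; apply/andP/eqP => [[/eqP x'y /TREE_config_minusP c]|->].
    by rewrite (xuniq x').
  by split; [apply/eqP|apply/TREE_config_minusP].
(* If all vertices lead to [x] and [x] exits to [y], then all lead to [y], against [noty]. *)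
rewrite big_pred0 // => x; apply/negbTE/negP => /andP[/eqP xy /TREE_config_minusP xconn].
move/negP: noty; apply; apply/TREE_config_minusP => v.
apply: connect_trans (xconn v) _; rewrite -xy; exact: fconnect1.
Qed.

(* Under mu the tree and the exit from y are independent, the latter with law q_y. *)
Lemma unicycle_exit_mean (x0 : V) y (g : nbr e y -> R) :
  \sum_(z : nbr e y) q y (val z) * g z = 0 ->
  \sum_s mu s * (if s.1 == y then g (s.2 y) else 0) = 0.
Proof.
move=> g0; have [rho0 _] := trees x0.
transitivity (\sum_x \sum_rho mu (x, rho) * (if x == y then g (rho y) else 0)).
  by rewrite pair_bigA; apply: eq_bigr => -[].
rewrite (bigD1 y) //= eqxx [X in _ + X]big1 => [|x /negPf ->]; last first.
  by rewrite big1 // => rho _; rewrite mulr0.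
have := sum_tree_config q rho0 (x := y) g; rewrite g0 mulr0 => h.
rewrite addr0; transitivity ((partition_constant e q)^-1 *
    \sum_(rho : config e | config_minus rho y \in TREE e y) cfg_weight q rho * g (rho y)).
  rewrite mulr_sumr [RHS]big_mkcond; apply: eq_bigr => rho _ /=.
  by case: ifP => _; rewrite ?mul0r // mulrA.
by rewrite h mulr0.
Qed.

End Stationarity.

(** * Walks that erase the initial configuration *)

Section Walks.
Hypothesis m_pos : forall x (z z' : nbr e x), 0 < m x z z'.
Hypothesis e_strong : forall x y : V, connect e x y.
Variable rho0 : config e.

Local Notation Kpos := (fun s t => 0 < K s t).

Lemma total_kernel_upd x rho (z : nbr e x) : 0 < K (x, rho) (val z, upd rho z).
Proof.
rewrite total_kernelE upd_in eqxx andbT -config_minus_agree config_minus_upd eqxx.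
exact: m_pos.
Qed.

(* The configuration after walking from x along p with initial configuration rho. *)
Fixpoint run (p : seq V) x rho : config e :=
  if p is y :: p' then
    run p' y (if insub y is Some z then upd rho (z : nbr e x) else rho)
  else rho.

Lemma run_nreach p x rho : path e x p ->
  nreach Kpos (size p) (x, rho) (last x p, run p x rho).
Proof.
elim: p x rho => [|y p IHp] x rho /=; first by rewrite eqxx.
move=> /andP[xy pth]; rewrite insubT.
apply: (@nreachD _ _ 1 (size p)) (IHp _ _ pth).
exact/nreach1/(total_kernel_upd rho (exist _ y xy : nbr e x)).
Qed.

(** [belast x p] lists the vertices that the walk exits; there the initial value is overwritten. *)
Lemma run_forget p x rho rho' v : path e x p ->
  v \in belast x p \/ rho v = rho' v -> run p x rho v = run p x rho' v.
Proof.
elim: p x rho rho' => [|y p IHp] x rho rho' /=; first by move=> _ [].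
move=> /andP[xy pth] h; rewrite insubT; apply: IHp => //.
have [->|vx] := eqVneq v x; first by right; rewrite !upd_in.
rewrite !upd_out //; case: h => [|]; last by right.
by rewrite inE (negPf vx) /=; left.
Qed.

(** All exits have positive probability whatever the configuration, so a walk in the graph lifts
    step by step. *)
Lemma nreach_lift n x y rho : nreach e n x y ->
  exists eta, nreach Kpos n (x, rho) (y, eta).
Proof.
elim: n y => [|n IHn] y.
  by move=> /eqP <-; exists rho; rewrite /= eqxx.
move=> /existsP[w /andP[/IHn[eta xw] wy]].
exists (upd eta (exist _ y wy : nbr e w)).
apply/existsP; exists (w, eta); apply/andP; split; first exact: xw.
exact: (total_kernel_upd eta (exist _ y wy : nbr e w)).
Qed.

Lemma config_out x : exists y, e x y.
Proof. by exists (val (rho0 x)); exact: valP. Qed.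

(** Walks to the listed vertices are concatenated, each followed by one more step so that its end is
    exited too; arbitrary steps then pad to any larger length. *)
Lemma covering_path c (vs : seq V) :
  exists l, forall n, (l <= n)%N -> exists p,
    [/\ path e c p, size p = n & {subset vs <= belast c p}].
Proof.
have [p [pth sub]] : exists p, path e c p /\ {subset vs <= belast c p}.
  elim: vs => [|v vs [p [pth sub]]]; first by exists [::].
  have /connectP[p1 pth1 lp1] := e_strong (last c p) v.
  have [y vy] := config_out v.
  exists (p ++ rcons p1 y); split; first by rewrite cat_path pth rcons_path pth1 -lp1.
  move=> u; rewrite inE belast_cat mem_cat => /orP[/eqP->|/sub ->//].
  by rewrite belast_rcons lp1 mem_last orbT.
exists (size p) => n /subnK <-; elim: (n - size p)%N => [|k [p' [pth' sz' sub']]].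
  by exists p.
have [y vy] := config_out (last c p').
exists (rcons p' y); rewrite rcons_path pth' vy size_rcons sz'; split=> // u /sub'.
by rewrite belast_rcons lastI mem_rcons inE => ->; rewrite orbT.
Qed.

(** A walk exiting every vertex ends in the same configuration from every [rho], so the run from the
    fixed [rho0] supplies [t]. *)
Lemma covering_state c : exists l, forall n, (l <= n)%N ->
  exists2 t, nreach e n c t.1 & forall rho, nreach Kpos n (c, rho) t.
Proof.
have [l H] := covering_path c (enum V); exists l => n /H[p [pth <- sub]].
exists (last c p, run p c rho0); first exact: nreach_path.
move=> rho; suff -> : run p c rho0 = run p c rho by apply: run_nreach.
by apply/ffunP => v; apply: run_forget => //; left; apply: sub; rewrite mem_enum.
Qed.

Lemma reachable_state (x0 : V) : exists t0, forall s, exists n, nreach Kpos n s t0.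
Proof.
have [l /(_ l (leqnn l))[t0 _ ct]] := covering_state x0; exists t0 => -[x rho].
have [k _ xx0] := strong_nreach e_strong config_out x x0.
have [eta step] := nreach_lift rho xx0.
by exists (k + l)%N; apply: nreachD step (ct eta).
Qed.

Lemma nreach_source n y : exists x, nreach e n x y.
Proof.
elim: n y => [|n IHn] y; first by exists y => /=.
have [[//|k] _ /existsP[z /andP[_ zy]]] := strong_nreach e_strong config_out y y.
by have [x xz] := IHn z; exists x; apply/existsP; exists z; apply/andP.
Qed.

(** * Decay along the cyclic classes leading to [y] *)

Section Target.
Variable y : V.

(** For [n] at least the eventual period these are the states located in one cyclic class; [hits 0]
    means being at [y]. *)
Definition hits n : pred S := fun s => nreach e n s.1 y.

Lemma Mop_hits_le n s : Mop K (ind R (hits n)) s <= ind R (hits n.+1) s.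
Proof.
have [h|h] := boolP (hits n.+1 s).
  rewrite (ind_in R h) -(total_kernel_stochastic.2 s); apply: ler_sum => t _.
  by rewrite ler_piMr ?total_kernel_ge0 // /ind lern1 leq_b1.
rewrite (ind_out R h) (Mop_ind_eq0 total_kernel_stochastic) // => t /total_kernel_edge st.
apply: contra h; rewrite /hits => ty.
exact: (@nreachD _ _ 1 n) (nreach1 st) ty.
Qed.

Lemma iter_Mop_hits_le n s : iter n (Mop K) (ind R (hits 0)) s <= ind R (hits n) s.
Proof.
elim: n s => //= n IHn s; apply: le_trans (Mop_hits_le n s).
by apply: (Mop_le total_kernel_stochastic) => t; exact: IHn.
Qed.

Variable p : nat.
Hypothesis p_gt0 : (0 < p)%N.
Hypothesis p_per : forall n x z, (p <= n)%N ->
  nreach e (n + p) x z = nreach e n x z.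

(** All successors of a vertex lie in one class, so a start in [hits n.+1] enters [hits n]
    surely. *)
Lemma Mop_hits n s : (p <= n)%N -> Mop K (ind R (hits n)) s = ind R (hits n.+1) s.
Proof.
move=> le_pn; have [h|h] := boolP (hits n.+1 s); last first.
  apply/eqP; rewrite eq_le Mop_hits_le (ind_out R h).
  by apply: (Mop_ge0 total_kernel_stochastic) => t; rewrite /ind ler0n.
rewrite (ind_in R h) (Mop_ind_eq1 total_kernel_stochastic) // => t /total_kernel_edge st.
exact: (nreach_successor e_strong config_out p_gt0 p_per le_pn h st).
Qed.

(** The first [p] steps bring the walk to a fixed vertex [x] of the class, the other [L * p] steps
    erase the configuration. *)
Lemma hits_minor : exists (N : nat) (c : R), 0 < c <= 1 /\
  forall n, (p <= n)%N -> exists2 t, hits n t &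
  forall s, hits (n + N)%N s -> forall g : S -> R, (forall u, 0 <= g u) ->
  c * g t <= iter N (Mop K) g s.
Proof.
have [c c01 cK] := positive_lower_bound (fun st : S * S => K st.1 st.2).
have c_ge0 : 0 <= c by case/andP: c01 => /ltW.
have /fin_all_exists[l lP] := covering_state.
(* [L * p] is at least every covering length and, as a positive multiple of [p], preserves the
   class. *)
pose L := (\sum_x l x).+1.
exists (p + L * p)%N, (c ^+ (p + L * p)); split.
  by case/andP: c01 => c_gt0 c_le1; rewrite exprn_gt0 // exprn_ile1.
move=> n le_pn; have [x xy] := nreach_source n y.
have [|t xt covt] := lP x (L * p)%N.
  have lx : (l x <= \sum_z l z)%N by rewrite (bigD1 x) //= leq_addr.
  by rewrite /L; nia.
exists t.
  apply: (nreach_target e_strong config_out p_gt0 p_per le_pn xy).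
  by rewrite -(nreach_period_mul p_per (\sum_z l z)) // -mulSn.
move=> [x' rho] hs g g_ge0.
apply: (iter_Mop_minor total_kernel_stochastic c_ge0) => //.
  by move=> u v; exact: (cK (u, v)).
have x'y : nreach e n x' y.
  have hs' : nreach e (n + (p + L * p)) x' y by exact: hs.
  by move: hs'; rewrite -mulSn (nreach_period_mul p_per).
have [eta step] := nreach_lift rho (nreach_reach e_strong config_out p_gt0 p_per x'y xy).
exact: nreachD step (covt eta).
Qed.

(** At [n = p] a single walk gives [c ^+ p]; by [Mop_hits] each further step keeps the same
    constant. *)
Lemma hits_lower : exists2 dl : R, 0 < dl & forall n, (p <= n)%N ->
  forall s, dl * ind R (hits n) s <= iter n (Mop K) (ind R (hits 0)) s.
Proof.
have [c c01 cK] := positive_lower_bound (fun st : S * S => K st.1 st.2).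
have c_ge0 : 0 <= c by case/andP: c01 => /ltW.
exists (c ^+ p) => [|n /subnK <-]; first by case/andP: c01 => ? _; rewrite exprn_gt0.
elim: (n - p)%N => [|k IHk] s.
  have ind0 t : 0 <= ind R (hits 0) t by rewrite /ind ler0n.
  have [h|h] := boolP (hits p s); last first.
    by rewrite (ind_out R h) mulr0; apply: (iter_Mop_ge0 total_kernel_stochastic).
  case: s h => x rho h; have [eta step] := nreach_lift rho h.
  have -> : ind R (hits (0 + p)) (x, rho) = ind R (hits 0) (y, eta).
    by rewrite (ind_in R h) ind_in // /hits /=.
  apply: (iter_Mop_minor total_kernel_stochastic c_ge0) => //.
  by move=> u v; exact: (cK (u, v)).
rewrite addSn -Mop_hits ?leq_addl //= /Mop mulr_sumr; apply: ler_sum => t _.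
by rewrite mulrCA ler_wpM2l ?total_kernel_ge0.
Qed.

Variable mu : S -> R.
Hypothesis mu_stat : stationary_distribution K mu.
Hypothesis mu_charges : forall x, exists rho, 0 < mu (x, rho).

(** The values on [hits n] end up in a short interval, and the zero mean under [mu], which charges
    the class, forces this interval to contain 0. *)
Lemma mean_zero_decay (f : S -> R) :
  (forall s, `|f s| <= ind R (hits 0) s) -> \sum_s mu s * f s = 0 ->
  forall eta : R, 0 < eta -> exists n0, forall n, (n0 <= n)%N ->
  forall s, `|iter n (Mop K) f s| <= eta * ind R (hits n) s.
Proof.
move=> f_le f_mean eta eta_gt0.
have [N [c [c01 minor]]] := hits_minor; have st := total_kernel_stochastic.
(* The initial width is 2, since the values lie between -1 and 1. *)
have base n : (p <= n)%N -> osc_le hits n 2 (iter n (Mop K) f).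
  move=> _; exists (-1) => s; have -> : -1 + 2 = 1 :> R by ring.
  rewrite mulN1r mul1r -ler_norml; apply: le_trans (iter_Mop_hits_le n s).
  rewrite ler_norml; apply/andP; split.
    have := iter_Mop_le st n (f := fun t => (-1) * ind R (hits 0) t + 0 * f t) (g := f).
    move=> h; apply: le_trans (h _ s).
      by rewrite iter_Mop_lin mul0r addr0 mulN1r.
    by move=> t; rewrite mul0r addr0 mulN1r; have := f_le t; rewrite ler_norml => /andP[].
  by apply: (iter_Mop_le st) => t; apply: le_trans (ler_norm _) (f_le t).
have [n0 small] := osc_le_small st c01 (fun n le_pn s => Mop_hits s le_pn)
  minor base (ler0n _ 2) eta_gt0.
exists n0 => n /small[w w_eta [a ah]] s.
have [mu0 mu1 muK] := mu_stat.
have fn0 : \sum_s mu s * iter n (Mop K) f s = 0 by rewrite stationary_sum_iter.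
have mass : 0 < \sum_s mu s * ind R (hits n) s.
  have [x xy] := nreach_source n y; have [rho rho_gt0] := mu_charges x.
  rewrite (bigD1 (x, rho)) //= ltr_pwDl //; first by rewrite ind_in // mulr1.
  by rewrite sumr_ge0 // => t _; rewrite mulr_ge0 // /ind ler0n.
have a_le0 : a <= 0.
  rewrite -(pmulr_lle0 _ mass) -[leRHS]fn0 mulr_sumr; apply: ler_sum => t _.
  by rewrite mulrCA ler_wpM2l //; case/andP: (ah t).
have aw_ge0 : 0 <= a + w.
  rewrite -(pmulr_lge0 _ mass) -[leLHS]fn0 mulr_sumr; apply: ler_sum => t _.
  by rewrite mulrCA ler_wpM2l //; case/andP: (ah t).
have i0 : 0 <= ind R (hits n) s by rewrite /ind ler0n.
have /andP[h1 h2] := ah s; rewrite ler_norml -mulNr; apply/andP; split.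
  by apply: le_trans h1; rewrite ler_wpM2r //; lra.
by apply: le_trans h2 _; rewrite ler_wpM2r //; lra.
Qed.

End Target.
End Walks.
End TotalKernel.

(** * Marginals of a Markov chain *)

Section MarkovMarginals.
Variables (R : realType) (S : finType) (K : S -> S -> R).
Variables (d : measure_display) (T : measurableType d) (P : probability T R).
Variable Z : nat -> T -> S.
Hypothesis Z_markov : markov_chain P Z K.

Let Z_meas n s : measurable (Z n @^-1` [set s]).
Proof. exact: Z_markov.1. Qed.

(** Raising [k] forgets the early past. *)
Definition cylinder k n (s : nat -> S) : set T :=
  [set w | forall i, (k <= i <= n)%N -> Z i w = s i].

Lemma measurable_cylinder k n s : measurable (cylinder k n s).
Proof.
have -> : cylinder k n s =
    \bigcap_(i in [set i | (k <= i <= n)%N]) (Z i @^-1` [set s i]).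
  by apply/seteqP; split.
by apply: bigcap_measurableType => // i _; exact: Z_meas.
Qed.

Lemma total_probability_formula k (B : set T) : measurable B ->
  P B = (\sum_(s : S) P (B `&` Z k @^-1` [set s]))%E.
Proof.
move=> mB; rewrite -[LHS](_ : P (\bigcup_(s in [set: S]) (B `&` Z k @^-1` [set s])) = _).
  rewrite measure_fin_bigcup //.
  - rewrite (fsbigE (index_enum S)) ?index_enum_uniq //.
      by apply: eq_bigl => s; exact: mem_set.
    by move=> s _; rewrite mem_index_enum.
  - exact: finite_finset.
  - apply/classical_sets.trivIsetP => s t _ _ st; apply/seteqP; split=> // w.
    by move=> [[_ /= ws] [_ /= wt]]; move: st; rewrite -ws -wt eqxx.
  - by move=> s _; apply: measurableI => //; exact: Z_meas.
congr (P _); apply/seteqP; split=> [w [s _ []]//|w Bw].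
by exists (Z k w).
Qed.

Lemma cylinder_update k n (s : nat -> S) u : (k < n)%N ->
  cylinder k.+1 n s `&` Z k @^-1` [set u] =
  cylinder k n (fun i => if i == k then u else s i).
Proof.
move=> lt_kn; apply/seteqP; split=> [w [/= ws wu] i|w /= wsu].
  by case: eqP => [->|/eqP ik] // /andP[ki iN]; apply: ws; rewrite ltn_neqAle eq_sym ik ki.
split=> [i /andP[ki iN]|]; last by have := wsu k; rewrite eqxx leqnn ltnW //; apply.
by have := wsu i; rewrite (gtn_eqF ki) iN ltnW //; apply.
Qed.

(** The definition of a Markov chain is the case [k = 0]; each induction step sums over the state at
    time [k]. *)
Lemma markov_cylinder k n s : (k <= n)%N ->
  P (cylinder k n.+1 s) = (P (cylinder k n s) * (K (s n) (s n.+1))%:E)%E.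
Proof.
elim: k s => [|k IHk] s le_kn; first exact: Z_markov.2.
rewrite (@total_probability_formula k (cylinder _ _ _)); last exact: measurable_cylinder.
rewrite (@total_probability_formula k (cylinder k.+1 n s)); last exact: measurable_cylinder.
under eq_bigr => u _ do rewrite cylinder_update ?(leq_trans le_kn) // IHk ?(ltnW le_kn) //
  (gtn_eqF le_kn) (gtn_eqF (ltn_trans le_kn (ltnSn n))).
rewrite ge0_sume_distrl; last by move=> *; exact: measure_ge0.
by apply: eq_bigr => u _; rewrite cylinder_update.
Qed.

Definition marginal n s : R := fine (P (Z n @^-1` [set s])).

Lemma marginalE n s : (marginal n s)%:E = P (Z n @^-1` [set s]).
Proof. by rewrite fineK // fin_num_measure. Qed.

Lemma marginal_ge0 n s : 0 <= marginal n s.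
Proof. exact: fine_ge0. Qed.

Lemma markov_pair n s t :
  P (Z n @^-1` [set s] `&` Z n.+1 @^-1` [set t]) = (marginal n s * K s t)%:E.
Proof.
pose st i := if i == n then s else t.
have := @markov_cylinder n n st (leqnn n).
have -> : cylinder n n.+1 st = Z n @^-1` [set s] `&` Z n.+1 @^-1` [set t].
  apply/seteqP; split=> w /=.
    move=> h; split.
      by have := h n; rewrite /st eqxx leqnn leqnSn; apply.
    by have := h n.+1; rewrite /st (gtn_eqF (ltnSn n)) leqnn leqnSn; apply.
  move=> [ws wt] i; rewrite leq_eqVlt => /andP[/orP[/eqP<- _|ni iN]].
    by rewrite /st eqxx.
  by have -> : i = n.+1 by [lia]; rewrite /st (gtn_eqF (ltnSn n)).
have -> : cylinder n n st = Z n @^-1` [set s].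
  apply/seteqP; split=> w /=.
    by move=> h; have := h n; rewrite /st eqxx !leqnn; apply.
  by move=> ws i; rewrite -eqn_leq => /eqP<-; rewrite /st eqxx.
by rewrite -marginalE /st eqxx (gtn_eqF (ltnSn n)) EFinM.
Qed.

Lemma marginalS n t : marginal n.+1 t = \sum_s marginal n s * K s t.
Proof.
apply: EFin_inj; rewrite marginalE (@total_probability_formula n) //.
by rewrite -sumEFin; apply: eq_bigr => s _; rewrite setIC markov_pair.
Qed.

Lemma measurable_event n (B : {pred S}) : measurable [set w | Z n w \in B].
Proof.
have -> : [set w | Z n w \in B] = \bigcup_(s in [set` B]) (Z n @^-1` [set s]).
  by apply/seteqP; split=> [w Bw|w [s Bs /= ->]//]; exists (Z n w).
by apply: fin_bigcup_measurable => [|s _]; [exact: finite_finset|exact: Z_meas].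
Qed.

Lemma marginal_event n (B : {pred S}) :
  P [set w | Z n w \in B] = (\sum_(s in B) marginal n s)%:E.
Proof.
rewrite (@total_probability_formula n); last exact: measurable_event.
rewrite [in RHS]big_mkcond -sumEFin; apply: eq_bigr => s _.
case: ifP => Bs.
  rewrite marginalE; congr (P _); apply/seteqP; split=> [w []//|w /= ws].
  by rewrite ws.
rewrite (_ : _ `&` _ = set0) ?measure0 //; apply/seteqP; split=> // w.
by move=> [/= + ws]; rewrite ws Bs.
Qed.

Lemma marginal_step_event n (A B : {pred S}) :
  P ([set w | Z n w \in A] `&` [set w | Z n.+1 w \in B]) =
  (\sum_(s in A) \sum_(t in B) marginal n s * K s t)%:E.
Proof.
set E := _ `&` _; have mE : measurable E by apply: measurableI; exact: measurable_event.
rewrite (@total_probability_formula n) // [in RHS]big_mkcond -sumEFin.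
apply: eq_bigr => s _; rewrite (@total_probability_formula n.+1); last first.
  by apply: measurableI => //; exact: Z_meas.
have [As|As] := boolP (s \in A); last first.
  apply: big1 => t _; rewrite (_ : _ `&` _ = set0) ?measure0 //.
  by apply/seteqP; split=> // w [[[/= + _] ws] _]; rewrite ws (negPf As).
rewrite [in RHS]big_mkcond -sumEFin; apply: eq_bigr => t _.
have [Bt|Bt] := boolP (t \in B); last first.
  rewrite (_ : _ `&` _ = set0) ?measure0 //.
  by apply/seteqP; split=> // w [[[/= _ +] _] wt]; rewrite wt (negPf Bt).
rewrite -markov_pair; congr (P _); apply/seteqP; split=> w /=.
  by move=> [[_ ws] wt].
by move=> [ws wt]; rewrite /E /= ws wt.
Qed.

End MarkovMarginals.

(** Duality: the law moves forward under [K] while the function moves backward under [Mop]. *)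
Lemma marginal_iter_Mop (R : realType) (S : finType) (K : S -> S -> R)
    (d : measure_display) (T : measurableType d) (P : probability T R)
    (Z : nat -> T -> S) (Z_markov : markov_chain P Z K) n (f : S -> R) :
  \sum_s marginal P Z n s * f s = \sum_s marginal P Z 0 s * iter n (Mop K) f s.
Proof.
elim: n f => // n IHn f; rewrite iterSr -IHn.
transitivity (\sum_t \sum_s marginal P Z n s * K s t * f t).
  by apply: eq_bigr => t _; rewrite (marginalS Z_markov) mulr_suml.
rewrite exchange_big; apply: eq_bigr => s _.
by rewrite /Mop mulr_sumr; apply: eq_bigr => t _; rewrite mulrA.
Qed.

(** Some [z] carries mass, and one step of the local chain passes part of it to [y]. *)
Lemma stationary_row_gt0 (R : realType) (V : finType) (e : rel V)
    (m : forall x : V, nbr e x -> nbr e x -> R) (q : V -> V -> R) x y :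
  (forall y z : nbr e x, 0 < m x y z) ->
  stationary_distribution (m x) (fun y : nbr e x => q x (val y)) ->
  e x y -> 0 < q x y.
Proof.
move=> m_pos /= [q_ge0 q_sum q_inv] xy.
have [z qz|q0] := pickP (fun z : nbr e x => 0 < q x (val z)); last first.
  have : \sum_(z : nbr e x) q x (val z) = 0.
    apply: big1 => z _; apply/eqP; apply: contraFT (q0 z).
    by rewrite lt_neqAle eq_sym q_ge0 andbT.
  by rewrite q_sum => /eqP; rewrite oner_eq0.
rewrite -[y]/(val (exist _ y xy : nbr e x)) -q_inv (bigD1 z) //=.
apply: ltr_pwDl; first by rewrite mulr_gt0.
by apply: sumr_ge0 => z' _; apply: mulr_ge0; [exact: q_ge0|exact/ltW/m_pos].
Qed.

(** * Stationary distribution and limiting exit probabilities *)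

Theorem theorem1p1 (R : realType) (V : finType) (e : rel V)
    (e_loopless : irreflexive e)
    (e_strong : forall x y : V, connect e x y)
    (m : forall x : V, nbr e x -> nbr e x -> R)
    (m_stochastic : forall x : V, stochastic (m x))
    (m_pos : forall (x : V) (y z : nbr e x), 0 < m x y z)
    (q : V -> V -> R)
    (q_stationary : forall x : V,
       stationary_distribution (m x) (fun y : nbr e x => q x (val y)))
    (q_ext : forall x y : V, ~~ e x y -> q x y = 0)
    (d : measure_display) (T : measurableType d) (P : probability T R)
    (X : nat -> T -> V) (rho0 : T -> config e)
    (X_lmw : locally_markov_walk P X rho0 m) :
  (stationary_distribution (total_kernel m) (unicycle_measure q) /\
   forall nu : V * config e -> R,
     stationary_distribution (total_kernel m) nu -> nu =1 unicycle_measure q) /\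
  (* The conditional probability is defined only when P(X_n = y) != 0; for a
     periodic walk this may fail for infinitely many n. *)
  (forall x y : V,
     cond_prob P [set w | X n.+1 w = x] [set w | X n w = y]
       @[n --> within [set n | P [set w | X n w = y] != 0%E] \oo]
     --> q y x).
Proof.
(* A probability space is nonempty; a sample point supplies a vertex and a configuration. *)
have [w0 _] : [set: T] !=set0.
  apply/set0P/eqP => T0; have := @probability_setT _ _ _ P.
  by rewrite T0 measure0 => -[] /esym /eqP; rewrite oner_eq0.
pose x0 := X 0 w0; pose cfg0 := rho0 w0.
have e_out := config_out cfg0.
have q_pos x y : e x y -> 0 < q x y.
  exact: (stationary_row_gt0 (m_pos x) (q_stationary x)).
have trees x : exists rho : config e, config_minus rho x \in TREE e x.
  apply: (spanning_tree_exists cfg0) => v.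
  by have [n _ vx] := strong_nreach e_strong e_out v x; exists n.
have mu_stat := unicycle_stationary q_stationary q_pos trees x0.
split.
  split=> // nu nu_stat.
  have [t0 reach] := reachable_state m_pos e_strong cfg0 x0.
  exact: (stationary_unique (total_kernel_stochastic m_stochastic) reach mu_stat).
move=> x y.
have Z_markov := lmw_total X_lmw; set Z := total_chain X rho0 in Z_markov.
have [p p_gt0 p_per] := nreach_eventually_periodic e.
have mu_charges v : exists rho : config e, 0 < unicycle_measure q (v, rho).
  have [rho tree] := trees v; exists rho.
  exact: (unicycle_measure_gt0 q_stationary q_pos trees tree).
(* [g z] is the probability of exiting [y] to [x] when the last exit was to [z], minus [q y x]; [f]
   is this error, restricted to being at [y]. *)
pose h (z z' : nbr e y) : R := m y z z' * (val z' == x)%:R.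
pose g (z : nbr e y) : R := \sum_z' h z z' - q y x.
pose f (s : V * config e) : R := if s.1 == y then g (s.2 y) else 0.
have /= [q_ge0 q_sum q_inv] := q_stationary y.
have q_mean : \sum_(z' : nbr e y) q y (val z') * (val z' == x)%:R = q y x.
  have [yx|yx] := boolP (e y x); last first.
    rewrite q_ext // big1 // => z _; case: eqP => [zx|_]; last by rewrite mulr0.
    by move: (valP z); rewrite /= zx (negPf yx).
  rewrite (bigD1 (exist _ x yx : nbr e y)) //= eqxx mulr1 big1 ?addr0 // => z zx.
  case: eqP => [zx'|_]; last by rewrite mulr0.
  by case/eqP: zx; apply: val_inj.
(* By invariance, a last exit with law [q y] is followed by an exit to [x] with probability
   [q y x]. *)
have g_mean : \sum_(z : nbr e y) q y (val z) * g z = 0.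
  under eq_bigr do rewrite mulrBr mulr_sumr.
  rewrite sumrB -mulr_suml q_sum mul1r exchange_big /= -[X in _ - X]q_mean.
  apply/eqP; rewrite subr_eq0; apply/eqP; apply: eq_bigr => z' _.
  rewrite -[X in _ = X * _]q_inv mulr_suml; apply: eq_bigr => z _.
  by rewrite /h mulrA.
have q_le1 : 0 <= q y x <= 1.
  rewrite -q_mean; apply/andP; split.
    by apply: sumr_ge0 => z _; apply: mulr_ge0; [exact: q_ge0|exact: ler0n].
  rewrite -[leRHS]q_sum; apply: ler_sum => z _.
  by apply: ler_piMr; [exact: q_ge0|rewrite lern1 leq_b1].
have f_le s : `|f s| <= ind R (hits y 0) s.
  rewrite /f /ind /hits /=; case: eqP => _; last by rewrite normr0.
  rewrite /g [leRHS](_ : _ = 1) // ler_norml; case/andP: q_le1 => q0 q1.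
  have [m_ge0 m_sum] := m_stochastic y.
  have h0 : 0 <= \sum_z' h (s.2 y) z'.
    by apply: sumr_ge0 => z' _; apply: mulr_ge0; [exact: m_ge0|exact: ler0n].
  have h1 : \sum_z' h (s.2 y) z' <= 1.
    rewrite -[leRHS](m_sum (s.2 y)); apply: ler_sum => z' _.
    by apply: ler_piMr; [exact: m_ge0|rewrite lern1 leq_b1].
  by move: (\sum_z' _) h0 h1 => a a0 a1; apply/andP; split; lra.
have f_mean := unicycle_exit_mean trees x0 g_mean.
have decay := mean_zero_decay m_stochastic m_pos e_strong cfg0 p_gt0 p_per
  mu_stat mu_charges f_le f_mean.
have [dl dl_gt0 lower] := hits_lower m_stochastic m_pos e_strong cfg0 y p_gt0 p_per.
pose A n := \sum_s marginal P Z n s * ind R (hits y 0) s.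
have AE n : P [set w | X n w = y] = (A n)%:E.
  have -> : [set w | X n w = y] = [set w | Z n w \in [pred s | s.1 == y]].
    by apply/seteqP; split=> w /= /eqP.
  rewrite (marginal_event Z_markov) [in LHS]big_mkcond /A; congr EFin.
  apply: eq_bigr => s _; rewrite inE /ind /hits /=.
  by case: eqP => _; rewrite ?mulr1 ?mulr0.
have BE n : P ([set w | X n.+1 w = x] `&` [set w | X n w = y]) =
    (q y x * A n + \sum_s marginal P Z n s * f s)%:E.
  have -> : [set w | X n.+1 w = x] `&` [set w | X n w = y] =
      [set w | Z n w \in [pred s | s.1 == y]] `&`
      [set w | Z n.+1 w \in [pred s | s.1 == x]].
    by apply/seteqP; split=> w /= []; rewrite !inE /= => /eqP ? /eqP ?.
  rewrite (marginal_step_event Z_markov) [in LHS]big_mkcond /A mulr_sumr -big_split.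
  congr EFin; apply: eq_bigr => -[v rho] _; rewrite inE /ind /hits /f /=.
  have [->|_] := eqVneq v y; last by rewrite !mulr0 addr0.
  rewrite mulr1 /g mulrBr [q y x * _]mulrC addrC subrK.
  rewrite -mulr_sumr; congr (_ * _).
  rewrite -(Mop_total _ (fun s => (s.1 == x)%:R)) /Mop [LHS]big_mkcond.
  by apply: eq_bigr => s _; rewrite inE; case: ifP; rewrite ?mulr1 ?mulr0.
apply/cvgrPdist_le => eps eps_gt0.
have [n0 small] := decay (eps * dl) (mulr_gt0 eps_gt0 dl_gt0).
exists (maxn p n0) => // n /=; rewrite geq_max => /andP[le_pn le_n0n] /=.
rewrite /cond_prob BE AE /= eqe => An_neq0.
(* [H] is the probability that the initial state lies in [hits y n]. It depends on [n], but bounds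
   the error by [eps * dl * H] and [A n] below by [dl * H], so it cancels in the quotient. *)
pose H := \sum_s marginal P Z 0 s * ind R (hits y n) s.
have A_ge : dl * H <= A n.
  rewrite /A (marginal_iter_Mop Z_markov) mulr_sumr; apply: ler_sum => s _.
  by rewrite mulrCA ler_wpM2l ?marginal_ge0 // lower.
have B_le : `|\sum_s marginal P Z n s * f s| <= eps * dl * H.
  rewrite (marginal_iter_Mop Z_markov) mulr_sumr (le_trans (ler_norm_sum _ _ _)) //.
  apply: ler_sum => s _; rewrite normrM ger0_norm ?marginal_ge0 //.
  by rewrite mulrCA ler_wpM2l ?marginal_ge0 // small.
have A_gt0 : 0 < A n.
  by rewrite lt_neqAle eq_sym An_neq0 -lee_fin -AE measure_ge0.
rewrite mulrDl mulfK // opprD addrA subrr sub0r normrN normrM normfV.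
rewrite (gtr0_norm A_gt0) ler_pdivrMr // (le_trans B_le) //.
by rewrite -mulrA ler_pM2l.
Qed.
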